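(* In the common agency setting, for every contract profile $(w_{P_1},\dots,w_{P_n})$ satisfying aggregate limited liability, there exists a profile of affine contracts $(\psi_{P_1},\dots,\psi_{P_n})$, with $\sum_i\psi_{P_i}\ge0$ on $\mathcal X$, such that $V_{P_i}(\boldsymbol\psi)\ge V_{P_i}(\boldsymbol w)$ for all $i\in[n]$.
   Context: Common agency setting: $n$ principals contract with one agent. $\mathcal X\subseteq\mathbb R_+^d$ compact (signals); $\mathcal A\subseteq\mathbb R_+^d$ compact, convex, downward-closed with $\mathcal A\subseteq\operatorname{conv}(\mathcal X)$ (actions); agent cost $c:\mathcal A\to\mathbb R_+$ strictly increasing, strictly convex, twice differentiable, $c(0)=0$. Principal $i$ has gross benefit $u_{P_i}:\mathcal A\to\mathbb R$ and offers a bounded contract $w_{P_i}:\mathcal X\to\mathbb R$; aggregate limited liability requires $\sum_iw_{P_i}(x)\ge0$ for all $x$. A distribution mapping $F$ assigns a distribution $F(a)$ on $\mathcal X$ to each action and is compatible if $\mathbb E_{x\sim F(a)}[x]=a$ for all $a$. Given $\boldsymbol w=(w_{P_1},\dots,w_{P_n})$ and $F$, the agent chooses $a^*\in\arg\max_a\{\mathbb E_{x\sim F(a)}[\sum_iw_{P_i}(x)]-c(a)\}$ (assumed to exist; ties broken by a fixed rule), and principal $i$'s payoff is $V_{P_i}(\boldsymbol w;F)=u_{P_i}(a^* )-\mathbb E_{x\sim F(a^* )}[w_{P_i}(x)]$. Worst-case payoff: $V_{P_i}(\boldsymbol w)=\inf_{F\text{ compatible}}V_{P_i}(\boldsymbol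 w;F)$. An affine contract pays $\psi_0+\sum_j\psi_jx_j$. *)

(* Defs.v *)
From HB Require Import structures.
From mathcomp Require Import all_boot all_order all_algebra.
From mathcomp Require Import all_classical all_reals all_analysis.
Set Implicit Arguments.
Unset Strict Implicit.
Unset Printing Implicit Defensive.
Import Order.TTheory GRing.Theory Num.Theory.
Import numFieldNormedType.Exports.
Local Open Scope classical_set_scope.
Local Open Scope ring_scope.

(* Points of R^d are row vectors 'rV[R]_d (topology/normed structure);
   signals are drawn by probability measures on d.-tuple R, which carries
   the product (= Borel) sigma-algebra; [rowt] identifies the two. *)
Definition rowt {R : realType} {d : nat} (t : d.-tuple R) : 'rV[R]_d :=
  \row_j tnth t j.


Definition vle {R : realType} {d : nat} (a b : 'rV[R]_d) : Prop :=
  forall j, a 0 j <= b 0 j.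
Definition nonneg_orthant {R : realType} {d : nat} (S : set 'rV[R]_d) : Prop :=
  forall x, S x -> forall j, 0 <= x 0 j.

Definition convex_set_rV {R : realType} {d : nat} (S : set 'rV[R]_d) : Prop :=
  forall a b t, S a -> S b -> 0 <= t -> t <= 1 -> S (t *: a + (1 - t) *: b).

Definition downward_closed {R : realType} {d : nat} (S : set 'rV[R]_d) : Prop :=
  forall a b, S a -> vle 0 b -> vle b a -> S b.

Definition conv_hull {R : realType} {d : nat} (S : set 'rV[R]_d) : set 'rV[R]_d :=
  [set x | exists (m : nat) (p : 'I_m -> 'rV[R]_d) (lam : 'I_m -> R),
     (forall i, S (p i)) /\ (forall i, 0 <= lam i) /\ \sum_(i < m) lam i = 1
     /\ x = \sum_(i < m) lam i *: p i].

Definition cost_ok {R : realType} {d : nat} (A : set 'rV[R]_d) (c : 'rV[R]_d -> R)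
  : Prop :=
  (forall a, A a -> 0 <= c a) /\ c 0 = 0 /\
  (forall a b, A a -> A b -> vle a b -> a != b -> c a < c b) /\
  (forall a b t, A a -> A b -> a != b -> 0 < t -> t < 1 ->
     c (t *: a + (1 - t) *: b) < t * c a + (1 - t) * c b) /\
  (forall a, A a -> differentiable c a) /\
  (forall v a, A a -> differentiable (fun x => 'D_v c x) a).

Definition contract_ok {R : realType} {d : nat} (X : set 'rV[R]_d)
  (w : 'rV[R]_d -> R) : Prop :=
  (exists M : R, forall x, X x -> `|w x| <= M) /\
  measurable_fun (rowt @^-1` X) (w \o (@rowt R d)).

Definition affine_contract {R : realType} {d : nat} (psi : 'rV[R]_d -> R) : Prop :=
  exists (psi0 : R) (b : 'rV[R]_d),
    forall x, psi x = psi0 + \sum_(j < d) b 0 j * x 0 j.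

Definition agg_LL {R : realType} {d n : nat} (X : set 'rV[R]_d)
  (w : 'I_n -> 'rV[R]_d -> R) : Prop :=
  forall x, X x -> 0 <= \sum_(i < n) w i x.

Local Open Scope ereal_scope.

Definition expect {R : realType} {d : nat}
  (mu : probability (d.-tuple R) R) (f : 'rV[R]_d -> R) : \bar R :=
  \int[mu]_t (f (rowt t))%:E.

Definition compatible {R : realType} {d : nat} (X A : set 'rV[R]_d)
  (F : 'rV[R]_d -> probability (d.-tuple R) R) : Prop :=
  forall a, A a ->
    F a (rowt @^-1` X) = 1 /\
    forall j : 'I_d, \int[F a]_t (tnth t j)%:E = (a 0 j)%:E.

Definition best_responses {R : realType} {d n : nat} (A : set 'rV[R]_d)
  (c : 'rV[R]_d -> R) (w : 'I_n -> 'rV[R]_d -> R)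
  (F : 'rV[R]_d -> probability (d.-tuple R) R) : set 'rV[R]_d :=
  let U := fun a => expect (F a) (fun x => (\sum_(i < n) w i x)%R) - (c a)%:E in
  [set a | A a /\ forall b, A b -> U b <= U a].

Definition tie_rule {R : realType} {d : nat} (A : set 'rV[R]_d)
  (tb : set 'rV[R]_d -> 'rV[R]_d) : Prop :=
  forall S, S `<=` A -> S !=set0 -> S (tb S).

Definition agent_action {R : realType} {d n : nat} (A : set 'rV[R]_d)
  (c : 'rV[R]_d -> R) (tb : set 'rV[R]_d -> 'rV[R]_d)
  (w : 'I_n -> 'rV[R]_d -> R) (F : 'rV[R]_d -> probability (d.-tuple R) R)
  : 'rV[R]_d := tb (best_responses A c w F).

Definition payoff {R : realType} {d n : nat} (A : set 'rV[R]_d)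
  (c : 'rV[R]_d -> R) (tb : set 'rV[R]_d -> 'rV[R]_d)
  (u : 'I_n -> 'rV[R]_d -> R) (w : 'I_n -> 'rV[R]_d -> R)
  (F : 'rV[R]_d -> probability (d.-tuple R) R) (i : 'I_n) : \bar R :=
  let a := agent_action A c tb w F in
  (u i a)%:E - expect (F a) (w i).

Definition worst_payoff {R : realType} {d n : nat} (X A : set 'rV[R]_d)
  (c : 'rV[R]_d -> R) (tb : set 'rV[R]_d -> 'rV[R]_d)
  (u : 'I_n -> 'rV[R]_d -> R) (w : 'I_n -> 'rV[R]_d -> R) (i : 'I_n) : \bar R :=
  ereal_inf [set payoff A c tb u w F i | F in compatible X A].

(* Main.v *)
(** The agent's net expected surplus over lotteries with a given mean is strictly
    concave up to the choice of lottery.  Since the agent has a best response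
    to every compatible [F], if [A] has at least two points then the supremum
    over all actions and lotteries is attained, at a unique action [a] and some
    lottery [mu]: otherwise one selects for each action a nearly optimal lottery,
    and the resulting [F] has no best response.  Let [W] be the aggregate contract and [g] the
    gradient of [c] at [a].  Mixing [mu] with the sure signal [0] (which is in
    [X] because [0] is in the convex hull of [X]) gives [g.a <= E_mu W].  Cost
    monotonicity allows replacing [g] by its positive part [b] without changing
    [g.x] on [A].  Then [E_mu W + b.(x - a)] is nonnegative on the whole orthant
    and implements [a] by strict convexity of [c]; the contracts
    [E_mu w_i + b.(x - a) / n] pay each principal, for every compatible
    distribution, what he gets under [w] when [F a = mu]. *)
Require Import Defs.
From HB Require Import structures.
From mathcomp Require Import all_boot all_order all_algebra.
From mathcomp Require Import all_classical all_reals all_analysis.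
From mathcomp Require Import measurable_realfun.
From mathcomp Require Import ring lra.
Import Order.TTheory GRing.Theory Num.Theory.
Import numFieldNormedType.Exports.
Import HBNNSimple.
Local Open Scope classical_set_scope.
Local Open Scope ring_scope.

(** * Measure theory of signal distributions *)

Lemma measurable_rowt_ball (R : realType) (d : nat) (q : 'rV[R]_d) (e : R) :
  measurable (rowt @^-1` ball q e).
Proof.
(* A ball of row vectors carries the condition [0 < e], which the intersection over coordinates
   forgets when [d] is 0. *)
have [e0|e0] := ltP 0 e; last first.
  rewrite (_ : _ @^-1` _ = set0); first exact: measurable0.
  by rewrite -subset0 => t /= [/lt_le_trans/(_ e0)]; rewrite ltxx.
rewrite (_ : _ @^-1` _ =
  \bigcap_(j in [set: 'I_d]) ((fun t : d.-tuple R => tnth t j) @^-1` ball (q 0 j) e)).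
  apply: fin_bigcap_measurable => // j _; rewrite -[X in measurable X]setTI.
  by apply: measurable_tnth => //; rewrite ball_itv; exact: measurable_itv.
apply/seteqP; split=> t /=.
  by move=> [_ B] j _ /=; have := B 0 j; rewrite mxE.
by move=> B; split=> // i j; rewrite ord1 mxE; exact: B.
Qed.

(** Compactness gives for each [k] a finite net of [X] with radius [1/(k+1)]. The union of its balls
    is measurable, and since [X] is closed, the intersection over [k] of these unions is [X]. *)
Lemma compact_measurable_rowt (R : realType) (d : nat) (X : set 'rV[R]_d) :
  compact X -> measurable (rowt @^-1` X).
Proof.
move=> cX.
have net k : exists s : seq 'rV[R]_d, (forall q, q \in s -> X q) /\
    X `<=` [set x | exists2 q, q \in s & ball q k.+1%:R^-1 x].
  have := cX; rewrite compact_cover => /(_ _ X (fun q => (ball q k.+1%:R^-1)°)).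
  case=> [q _|x Xx|s sX sc]; first exact: open_interior.
    exists x => //; apply: nbhsx_ballx; by rewrite invr_gt0 ltr0n.
  exists (finmap.enum_fset s); split=> [q /sX|x /sc [q qs bqx]]; first by rewrite inE.
  by exists q => //; exact: interior_subset bqx.
have [s /all_and2[sX sc]] := choice net.
rewrite (_ : _ @^-1` _ = \bigcap_k \bigcup_(q in [set` s k])
    (rowt @^-1` ball q k.+1%:R^-1)).
  apply: bigcap_measurableType => k _; apply: fin_bigcup_measurable.
    exact: finite_seq.
  by move=> q _; exact: measurable_rowt_ball.
apply/seteqP; split=> t /=.
  by move=> Xt k _; have [q qs bq] := sc k _ Xt; exists q.
move=> H; apply: (compact_closed _ cX); first exact: norm_hausdorff.
move=> B /nbhs_ballP[e /= e0 eB].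
have [k ke] : exists k, k.+1%:R^-1 < e.
  by have [k _ kP] := near_infty_natSinv_lt (PosNum e0); exists k; exact: kP (leqnn k).
have [q /= qs bq] := H k I.
exists q; split; first exact: sX qs.
by apply: eB; apply: le_ball (ltW ke) _ _; exact: ball_sym.
Qed.

(* No measurability of [f] outside [D] is available: contracts are arbitrary
   functions off the signal space. *)
Lemma integral_full_measure {d} {T : measurableType d} {R : realType}
    (mu : {measure set T -> \bar R}) (D : set T) (f : T -> \bar R) :
  measurable D -> mu (~` D) = 0%E ->
  (\int[mu]_t f t = \int[mu]_(t in D) f t)%E.
Proof.
move=> mD mu0.
have ge0 (g : T -> \bar R) : (forall t, 0 <= g t)%E ->
    (\int[mu]_t g t = \int[mu]_(t in D) g t)%E.
  move=> g0; rewrite ge0_integralTE// ge0_integralE//.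
  apply/eqP; rewrite eq_le; apply/andP; split; last first.
    apply: ereal_sup_le => _ /= [h hg <-]; exists h => // t.
    by apply: (le_trans (hg t)); rewrite /patch; case: ifP.
  (* The integral of a nonnegative [f] is a supremum over simple functions below [f]. Cutting such
     an [h] down to [D] keeps it below the restriction of [f] and changes it only on a null set. *)
  apply: ge_ereal_sup => _ /= [h hg <-].
  have -> : sintegral mu h = sintegral mu (h \_ D).
    rewrite -integralT_nnsfun -integral_nnsfun//.
    rewrite (@ge0_negligible_integral _ _ _ mu setT (~` D)) ?setTD ?setCK//.
    - exact: measurableC.
    - exact/measurable_EFinP.
    - by move=> t _; rewrite lee_fin.
  apply: ereal_sup_ubound => /=.
  exists (proj_nnsfun h mD); last by rewrite -mrestrict.
  move=> t /=; rewrite /patch mindicE; case: ifP => _; first by rewrite mulr1.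
  by rewrite mulr0.
rewrite integralE [RHS]integralE; congr (_ - _)%E; apply: ge0 => t.
  exact: funepos_ge0.
exact: funeneg_ge0.
Qed.

Lemma probability_mixture {d} {T : measurableType d} {R : realType} (m : nat)
    (lam : 'I_m -> R) (mu : 'I_m -> probability T R) :
  (forall i, 0 <= lam i) -> \sum_(i < m) lam i = 1 ->
  exists nu : probability T R, forall D (f : T -> \bar R), measurable D ->
    measurable_fun D f -> (forall x, D x -> 0 <= f x)%E ->
    (\int[nu]_(x in D) f x =
     \sum_(i < m) (lam i)%:E * \int[mu i]_(x in D) f x)%E.
Proof.
move=> lam0 lam1.
(* [msum] takes a sequence indexed by [nat], so the family is padded with the zero measure from [m]
   on. *)
pose P (k : nat) : {measure set T -> \bar R} := if insub k is Some i then
  mscale (NngNum (lam0 i)) (mu i) else mzero.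
pose nu0 := msum P m.
have PE (i : 'I_m) : P i = mscale (NngNum (lam0 i)) (mu i) by rewrite /P valK.
have nuT : nu0 setT = 1%E.
  rewrite /nu0 /msum (eq_bigr (fun i => (lam i)%:E)) ?sumEFin ?lam1// => i _.
  by rewrite PE -[RHS]mule1 -(probability_setT (mu i)).
pose M := Measure_isProbability.Build _ _ _ nu0 nuT.
pose nu : probability T R := HB.pack nu0 M.
exists nu => D f mD mf f0.
rewrite [LHS](_ : _ = \int[nu0]_(x in D) f x)%E//.
rewrite ge0_integral_measure_sum//; apply: eq_bigr => i _.
by rewrite PE ge0_integral_mscale.
Qed.

(** * Lotteries *)

(** This is the condition that [compatible] puts on a single [F a], isolated so that the
    distribution at each action can be chosen separately. *)
Definition lottery {R : realType} {d : nat} (X : set 'rV[R]_d) (a : 'rV[R]_d)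
    (mu : probability (d.-tuple R) R) : Prop :=
  mu (rowt @^-1` X) = 1%E /\
  forall j : 'I_d, (\int[mu]_t (tnth t j)%:E = (a 0 j)%:E)%E.

Definition mean {R : realType} {d : nat} (mu : probability (d.-tuple R) R)
  (f : 'rV[R]_d -> R) : R := fine (expect mu f).

Section lotteries.
Context {R : realType} {d : nat} (X : set 'rV[R]_d) (cX : compact X).
Implicit Types (f : 'rV[R]_d -> R) (mu : probability (d.-tuple R) R).
Let D : set (d.-tuple R) := rowt @^-1` X.

Let mD : measurable D. Proof. exact: compact_measurable_rowt. Qed.

Lemma contract_ok_cst k : contract_ok X (fun=> k).
Proof. by split; [exists `|k| | exact: measurable_cst]. Qed.

Lemma contract_ok_coord (j : 'I_d) : contract_ok X (fun x => x 0 j).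
Proof.
split.
  have [M [_ HM]] := compact_bounded cX.
  exists (M + 1) => x Xx; have M1 : M < M + 1 by rewrite ltrDl.
  apply: le_trans (HM _ M1 x Xx).
  rewrite [leRHS]mx_normrE.
  exact: (le_bigmax _ (fun ij : 'I_1 * 'I_d => `|x ij.1 ij.2|) (0, j)).
apply: measurable_funTS; rewrite (_ : _ \o _ = fun t => tnth t j).
  exact: measurable_tnth.
by apply/funext => t /=; rewrite mxE.
Qed.

Lemma contract_okD f g : contract_ok X f -> contract_ok X g ->
  contract_ok X (fun x => f x + g x).
Proof.
move=> [[M Mf] mf] [[N Ng] mg]; split.
  exists (M + N) => x Xx; apply: (le_trans (ler_normD _ _)).
  by apply: lerD; [exact: Mf|exact: Ng].
exact: measurable_funD.
Qed.

Lemma contract_okZ k f : contract_ok X f -> contract_ok X (fun x => k * f x).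
Proof.
move=> [[M Mf] mf]; split.
  by exists (`|k| * M) => x Xx; rewrite normrM ler_wpM2l// Mf.
by apply: measurable_funM => //; exact: measurable_cst.
Qed.

Lemma contract_ok_sum n (w : 'I_n -> 'rV[R]_d -> R) :
  (forall i, contract_ok X (w i)) -> contract_ok X (fun x => \sum_(i < n) w i x).
Proof.
move=> ok; elim: n w ok => [|n IH] w ok.
  by rewrite (_ : (fun _ => _) = fun=> 0);
    [exact: contract_ok_cst | apply/funext => x; rewrite big_ord0].
rewrite (_ : (fun _ => _) =
    fun x => \sum_(i < n) w (widen_ord (leqnSn n) i) x + w ord_max x).
  by apply: contract_okD => //; exact: IH.
by apply/funext => x; rewrite big_ord_recr.
Qed.

Lemma contract_ok_affine p (b : 'rV[R]_d) :
  contract_ok X (fun x => p + \sum_(j < d) b 0 j * x 0 j).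
Proof.
apply: contract_okD; first exact: contract_ok_cst.
by apply: contract_ok_sum => j; apply: contract_okZ; exact: contract_ok_coord.
Qed.

Lemma full_expectE mu f : mu D = 1%E ->
  expect mu f = (\int[mu]_(t in D) (f (rowt t))%:E)%E.
Proof.
move=> mu1; apply: integral_full_measure => //.
by have := probability_setC mu mD; rewrite mu1 subee.
Qed.

Lemma contract_integrable mu f : contract_ok X f ->
  mu.-integrable D (EFin \o (f \o rowt)).
Proof.
move=> [[M Mf] mf]; apply: measurable_bounded_integrable => //.
  by rewrite (le_lt_trans (probability_le1 mu mD))// ltry.
exists M; split; first exact: num_real.
by move=> N MN t Dt /=; apply: le_trans (ltW MN); exact: Mf.
Qed.

Lemma full_expect_mean mu f : mu D = 1%E -> contract_ok X f ->
  expect mu f = (mean mu f)%:E.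
Proof.
move=> mu1 okf; rewrite /mean fineK// full_expectE//.
by apply: integrable_fin_num => //; exact: contract_integrable okf.
Qed.

Lemma mean_cst mu k : mu D = 1%E -> mean mu (fun=> k) = k.
Proof.
by move=> mu1; rewrite /mean full_expectE// integral_cst//= mu1 mule1.
Qed.

Lemma meanD mu f g : mu D = 1%E -> contract_ok X f -> contract_ok X g ->
  mean mu (fun x => f x + g x) = mean mu f + mean mu g.
Proof.
move=> mu1 okf okg; apply/EFin_inj.
rewrite EFinD -!full_expect_mean ?full_expectE//; last exact: contract_okD.
by rewrite -integralD//; exact: contract_integrable.
Qed.

Lemma meanZ mu k f : mu D = 1%E -> contract_ok X f ->
  mean mu (fun x => k * f x) = k * mean mu f.
Proof.
move=> mu1 okf; apply/EFin_inj.
rewrite EFinM -!full_expect_mean ?full_expectE//; last exact: contract_okZ.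
by rewrite -integralZl//; exact: contract_integrable.
Qed.

Lemma mean_sum mu n (w : 'I_n -> 'rV[R]_d -> R) : mu D = 1%E ->
  (forall i, contract_ok X (w i)) ->
  mean mu (fun x => \sum_(i < n) w i x) = \sum_(i < n) mean mu (w i).
Proof.
move=> mu1; elim: n w => [|n IH] w ok.
  rewrite big_ord0 (_ : (fun _ => _) = fun=> 0) ?mean_cst//.
  by apply/funext => x; rewrite big_ord0.
rewrite big_ord_recr /= -IH// -meanD//; last exact: contract_ok_sum.
by congr mean; apply/funext => x; rewrite big_ord_recr.
Qed.

Lemma le_mean mu f g : mu D = 1%E -> contract_ok X f -> contract_ok X g ->
  (forall x, X x -> f x <= g x) -> mean mu f <= mean mu g.
Proof.
move=> mu1 okf okg fg; rewrite -lee_fin -!full_expect_mean ?full_expectE//.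
apply: le_integral => //; [exact: contract_integrable|exact: contract_integrable|].
by move=> t /[!inE] Dt; rewrite lee_fin; exact: fg.
Qed.

Lemma lottery_affine a mu p (b : 'rV[R]_d) : lottery X a mu ->
  mean mu (fun x => p + \sum_(j < d) b 0 j * x 0 j)
  = p + \sum_(j < d) b 0 j * a 0 j.
Proof.
move=> [mu1 mua].
have okc j := contract_okZ (b 0 j) _ (contract_ok_coord j).
rewrite meanD ?mean_cst//; [|exact: contract_ok_cst|exact: contract_ok_sum].
rewrite mean_sum//; congr (_ + _); apply: eq_bigr => j _.
rewrite meanZ//; last exact: contract_ok_coord.
congr (_ * _); rewrite /mean -[RHS]/(fine (a 0 j)%:E) -mua.
by congr fine; apply: eq_integral => t _; rewrite mxE.
Qed.

Lemma lottery_mixture m (lam : 'I_m -> R) (a : 'I_m -> 'rV[R]_d)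
    (mu : 'I_m -> probability (d.-tuple R) R) :
  (forall i, 0 <= lam i) -> \sum_(i < m) lam i = 1 ->
  (forall i, lottery X (a i) (mu i)) ->
  exists2 nu, lottery X (\sum_(i < m) lam i *: a i) nu &
    forall f, contract_ok X f -> mean nu f = \sum_(i < m) lam i * mean (mu i) f.
Proof.
move=> lam0 lam1 lot.
have [nu nuE] := probability_mixture m lam mu lam0 lam1.
have mu1 i : mu i D = 1%E by have [] := lot i.
have nu1 : nu D = 1%E.
  have := nuE D (cst 1%E) mD; rewrite integral_cst// mul1e => ->//.
  rewrite (eq_bigr (fun i => (lam i)%:E)) ?sumEFin ?lam1// => i _.
  by rewrite integral_cst// mul1e -[RHS]mule1; congr (_ * _)%E; exact: mu1.
have meanE f : contract_ok X f -> mean nu f = \sum_(i < m) lam i * mean (mu i) f.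
  move=> okf; have [[M Mf] mf] := okf.
  (* The mixture formula covers nonnegative integrands only. The shift by the bound [M] makes [f]
     nonnegative on [X], and it cancels because the weights sum to 1. *)
  have okM : contract_ok X (fun x => f x + M).
    by apply: contract_okD => //; exact: contract_ok_cst.
  have : mean nu (fun x => f x + M)
      = \sum_(i < m) lam i * mean (mu i) (fun x => f x + M).
    apply/EFin_inj; rewrite -sumEFin -full_expect_mean// full_expectE// nuE//.
    - apply: eq_bigr => i _; rewrite EFinM -full_expect_mean//.
      by rewrite full_expectE.
    - by apply/measurable_EFinP; case: okM.
    - by move=> t Dt; rewrite lee_fin; have := Mf _ Dt; rewrite ler_norml; lra.
  rewrite meanD ?mean_cst//; last exact: contract_ok_cst.
  rewrite (eq_bigr (fun i => lam i * mean (mu i) f + lam i * M)); last first.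
    by move=> i _; rewrite meanD ?mean_cst ?mulrDr//; exact: contract_ok_cst.
  by rewrite big_split/= -mulr_suml lam1 mul1r => /addIr.
exists nu => //; split=> // j.
have coordE (rho : probability (d.-tuple R) R) : (\int[rho]_t (tnth t j)%:E)%E = expect rho (fun x => x 0 j).
  by apply: eq_integral => t _; rewrite mxE.
have okj := contract_ok_coord j.
rewrite coordE full_expect_mean// meanE// summxE; congr EFin.
apply: eq_bigr => i _; rewrite mxE; congr (_ * _); apply/EFin_inj.
by rewrite -full_expect_mean// -coordE; have [] := lot i.
Qed.

Lemma lottery_dirac x : X x ->
  exists2 mu, lottery X x mu & forall f, contract_ok X f -> mean mu f = f x.
Proof.
move=> Xx; pose t : d.-tuple R := [tuple x 0 j | j < d].
have tx : rowt t = x by apply/rowP => j; rewrite mxE tnth_mktuple.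
have Dt : D t by rewrite /D /= tx.
pose mu : probability (d.-tuple R) R := dirac t.
have mu1 : mu D = 1%E by rewrite /mu /= diracE mem_set.
have muE f : contract_ok X f -> mean mu f = f x.
  move=> [_ mf]; rewrite /mean full_expectE// integral_dirac//.
    by rewrite mu1 mul1e /= tx.
  exact/measurable_EFinP.
exists mu => //; split=> // j.
transitivity (expect mu (fun x => x 0 j)).
  by apply: eq_integral => s _; rewrite mxE.
have okj := contract_ok_coord j.
by rewrite full_expect_mean// muE.
Qed.

Lemma lottery_conv_hull a : conv_hull X a -> exists mu, lottery X a mu.
Proof.
move=> [m [p [lam [Xp [lam0 [lam1 ->]]]]]].
have /choice[mu muP] i : exists nu, lottery X (p i) nu.
  by have [nu ? _] := lottery_dirac _ (Xp i); exists nu.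
by have [nu ? _] := lottery_mixture m lam p mu lam0 lam1 muP; exists nu.
Qed.
End lotteries.

(** * Attainment and directional derivatives *)

Lemma mix_neq {R : fieldType} {V : lmodType R} (a b : V) (t : R) :
  t != 0 -> a != b -> t *: a + (1 - t) *: b != b.
Proof.
move=> t0; apply: contra_neq => /eqP; rewrite -subr_eq0 scalerBl scale1r.
rewrite addrA addrAC addrK -scalerBr scaler_eq0 (negbTE t0) subr_eq0.
by move=> /eqP.
Qed.

(** Here [Q a s] reads: the value [s] can be obtained at [a]. The values at one point need not have
    a maximum; attainment is extracted from the maximizers of well-chosen selections [f]. *)
Lemma strictly_concave_selection_max {R : realType} {V : lmodType R}
    (A : set V) (Q : V -> R -> Prop) (M : R) :
  A !=set0 ->
  (forall a b t, A a -> A b -> 0 <= t -> t <= 1 -> A (t *: a + (1 - t) *: b)) ->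
  (forall a, A a -> exists s, Q a s) ->
  (forall a s, A a -> Q a s -> s <= M) ->
  (forall a b t, A a -> A b -> a != b -> 0 < t -> t < 1 ->
    exists2 g, 0 < g & forall r s, Q a r -> Q b s ->
      Q (t *: a + (1 - t) *: b) (t * r + (1 - t) * s + g)) ->
  (forall f : V -> R, (forall a, A a -> Q a (f a)) ->
    exists2 a, A a & forall b, A b -> f b <= f a) ->
  exists a s, [/\ A a, Q a s & forall b r, A b -> Q b r -> b != a -> r < s].
Proof.
move=> [a0 Aa0] convA Qex QM Qconc sel.
have h0 : 0 < 2^-1 :> R by lra.
have h1 : 2^-1 < 1 :> R by lra.
(* A competitor at [b] with value at least [s] would produce, at the midpoint with [a], a value
   above [s] at a point other than [a]. *)
have strict a s : A a -> Q a s ->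
    (forall b r, A b -> Q b r -> b != a -> r <= s) ->
    forall b r, A b -> Q b r -> b != a -> r < s.
  move=> Aa Qs le b r Ab Qr ba; rewrite ltNge; apply/negP => sr.
  have [g g0 /(_ _ _ Qr Qs) Qm] := Qconc b a _ Ab Aa ba h0 h1.
  have Am := convA b a _ Ab Aa (ltW h0) (ltW h1).
  by have := le _ _ Am Qm (mix_neq _ _ _ (lt0r_neq0 h0) ba); lra.
(* With a single action nothing forces attainment, and none is claimed. *)
have [single|/existsNP[z0 /not_implyP[Az0 z0a0]]] :=
    pselect (forall b, A b -> b = a0).
  have [s Qs] := Qex _ Aa0.
  by exists a0, s; split=> // b r Ab _; rewrite (single b Ab) eqxx.
have other a : exists2 z, A z & z != a.
  by have [<-|] := eqVneq a0 a; [exists z0 => //; exact/eqP|exists a0].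
pose S := [set s | exists2 a, A a & Q a s].
have supS : has_sup S.
  split; first by have [s Qs] := Qex _ Aa0; exists s, a0.
  by exists M => s [a Aa Qs]; exact: QM Qs.
set v := sup S.
have ubS a s : A a -> Q a s -> s <= v.
  by move=> Aa Qs; apply: sup_upper_bound => //; exists a.
have [[a [s [Aa Qs sv]]]|noatt] :=
    pselect (exists a s, [/\ A a, Q a s & v <= s]).
  exists a, s; split=> //; apply: strict => // b r Ab Qr _.
  exact: le_trans (ubS _ _ Ab Qr) sv.
have ltS a s : A a -> Q a s -> s < v.
  by move=> Aa Qs; rewrite ltNge; apply/negP => vs; apply: noatt; exists a, s.
pose full a := forall e, 0 < e -> exists2 s, Q a s & v - e < s.
(* If the values at [a] stay [e] below [v], then a [t] within [e] of their supremum has a gap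
   [v - t] at most twice the gap of any other value at [a]. *)
have goodex a : exists t, A a ->
    Q a t /\ (~ full a -> forall s, Q a s -> v - t <= 2 * (v - s)).
  have [Aa|] := pselect (A a); last by exists 0.
  have [s0 Qs0] := Qex _ Aa.
  have [fa|nfa] := pselect (full a); first by exists s0 => _; split.
  have /existsNP[e /not_implyP[e0 noe]] := nfa.
  have le s : Q a s -> s <= v - e.
    by move=> Qs; rewrite leNgt; apply/negP => lt; apply: noe; exists s.
  have sup_a : has_sup (Q a) by split; [exists s0|exists (v - e) => s /le].
  have [t Qt ltt] := sup_adherent e0 sup_a.
  exists t => _; split=> // _ s Qs.
  have := sup_upper_bound sup_a Qs; have := ge_sup sup_a.1 le.
  lra.
have [f fP] := choice goodex.
have [ah Aah fmax] := sel f (fun a Aa => (fP a Aa).1).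
(* If a point that is not full had a value above [v - e], the factor 2 would force its selected
   value above the maximum [f ah]. *)
pose e := (v - f ah) / 2.
have e0 : 0 < e by rewrite /e; have := ltS _ _ Aah (fP _ Aah).1; lra.
have near_full b s : A b -> Q b s -> v - e < s -> full b.
  move=> Ab Qs lts; apply: contrapT => /((fP b Ab).2) /(_ _ Qs).
  by have := fmax b Ab; move: lts; rewrite /e; lra.
have [s [b Ab Qs] lts] := sup_adherent e0 supS.
have fb := near_full b s Ab Qs lts.
(* If [v] is approached but not attained at [b], it is also approached at a
   point between [b] and [z], and strict concavity beats [v] in the middle. *)
have [z Az zb] := other b; have [r Qr] := Qex z Az.
(* The weight [t] on [z] is so small that the loss [t * K] stays below the margin [g], so the mixed
   point still has a value above [v - e] and is full. The added 1 keeps [t < 1]. *)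
pose g := s - (v - e); pose K := `|s - r|.
pose t := g / (g + K + 1).
have g0 : 0 < g by rewrite /g subr_gt0.
have K0 : 0 <= K by exact: normr_ge0.
have D0 : 0 < g + K + 1 by lra.
have t0 : 0 < t by rewrite divr_gt0.
have t1 : t < 1 by rewrite ltr_pdivrMr// mul1r; lra.
have tK : t * K < g by rewrite mulrAC ltr_pdivrMr// ltr_pM2l//; lra.
have [e1 e10 /(_ _ _ Qr Qs) Qb'] := Qconc z b t Az Ab zb t0 t1.
have Ab' := convA z b t Az Ab (ltW t0) (ltW t1).
set b' := _ + _ in Qb' Ab'.
have fb' : full b'.
  apply: near_full Qb' _ => //.
  have : t * (s - r) <= t * K by rewrite ler_wpM2l ?ler_norm// ltW.
  by move: tK; rewrite /g; lra.
have bb' : b != b' by rewrite eq_sym; apply: mix_neq => //; exact: lt0r_neq0.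
have [e2 e20 Qm] := Qconc b b' _ Ab Ab' bb' h0 h1.
have [s1 Qs1 lts1] := fb _ e20.
have [s2 Qs2 lts2] := fb' _ e20.
have := ubS _ _ (convA b b' _ Ab Ab' (ltW h0) (ltW h1)) (Qm _ _ Qs1 Qs2).
lra.
Qed.

Section directional.
Context {R : realType} {d : nat} (f : 'rV[R]_d -> R) (x v : 'rV[R]_d).
Hypothesis df : differentiable f x.

(** Restricting the limit to [h > 0] lets derivative bounds be read off segments leaving [x] in one
    direction, which is all that is available at the boundary of [A]. *)
Let cvg_quotient :
  (h^-1 * (f (h *: v + x) - f x)) @[h --> 0^'+] --> ('D_v f x : R).
Proof.
have dv : derivable f x v by exact: diff_derivable.
apply: cvg_trans dv; apply: cvg_app; apply: within_subset => h /= h0.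
by rewrite gt_eqF.
Qed.

Lemma derive_le k :
  (forall t, 0 < t -> t < 1 -> f (t *: v + x) - f x <= t * k) -> 'D_v f x <= k.
Proof.
move=> H; apply: cvgr_to_le cvg_quotient _; near=> h.
have h0 : 0 < h by near: h; exact: nbhs_right_gt.
by rewrite mulrC ler_pdivrMr// mulrC H//; near: h; exact: nbhs_right_lt.
Unshelve. all: by end_near. Qed.

Lemma derive_ge k :
  (forall t, 0 < t -> t < 1 -> t * k <= f (t *: v + x) - f x) -> k <= 'D_v f x.
Proof.
move=> H; apply: cvgr_to_ge cvg_quotient _; near=> h.
have h0 : 0 < h by near: h; exact: nbhs_right_gt.
by rewrite mulrC ler_pdivlMr// mulrC H//; near: h; exact: nbhs_right_lt.
Unshelve. all: by end_near. Qed.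

Lemma derive_coord :
  'D_v f x = \sum_(j < d) 'D_(delta_mx 0 j) f x * v 0 j.
Proof.
rewrite deriveE// [in LHS](row_sum_delta v) linear_sum; apply: eq_bigr => j _.
by rewrite linearZ deriveE// mulrC.
Qed.
End directional.

(** * Cost functions *)

Section cost.
Context {R : realType} {d : nat} (A : set 'rV[R]_d) (c : 'rV[R]_d -> R).
Hypotheses (Apos : nonneg_orthant A) (Aconv : convex_set_rV A)
  (Adown : downward_closed A) (cok : cost_ok A c).

Lemma downward_scale a t : A a -> 0 <= t -> t <= 1 -> A (t *: a).
Proof.
move=> Aa t0 t1; apply: (Adown a _ Aa) => j; rewrite !mxE.
  by rewrite mulr_ge0// Apos.
by rewrite ler_piMl// Apos.
Qed.

Let conv a b t : A a -> A b -> 0 <= t -> t <= 1 ->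
  c (t *: a + (1 - t) *: b) <= t * c a + (1 - t) * c b.
Proof.
move=> Aa Ab; rewrite le_eqVlt => /predU1P[<- _|t0].
  by rewrite scale0r mul0r !add0r subr0 scale1r mul1r.
rewrite le_eqVlt => /predU1P[->|t1].
  by rewrite subrr scale0r mul0r !addr0 scale1r mul1r.
have [->|ab] := eqVneq a b.
  by rewrite -scalerDl -mulrDl addrC subrK scale1r mul1r.
by have [_ [_ [_ [sc _]]]] := cok; rewrite ltW// sc.
Qed.

Lemma cost_mono a b : A a -> A b -> vle a b -> c a <= c b.
Proof.
move=> Aa Ab ab; have [->//|nab] := eqVneq a b.
by have [_ [_ [mono _]]] := cok; rewrite ltW// mono.
Qed.

Lemma cost_tangent a b : A a -> A b ->
  c a + \sum_(j < d) 'D_(delta_mx 0 j) c a * (b 0 j - a 0 j) <= c b.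
Proof.
move=> Aa Ab.
have dca : differentiable c a by have [_ [_ [_ [_ [dc _]]]]] := cok; exact: dc.
have -> : \sum_(j < d) 'D_(delta_mx 0 j) c a * (b 0 j - a 0 j) = 'D_(b - a) c a.
  by rewrite derive_coord//; apply: eq_bigr => j _; rewrite !mxE.
rewrite addrC -lerBrDr; apply: derive_le => // t t0 t1.
have -> : t *: (b - a) + a = t *: b + (1 - t) *: a.
  by rewrite scalerBr scalerBl scale1r -!addrA [_ + a]addrC.
have := conv b a t Ab Aa (ltW t0) (ltW t1); lra.
Qed.

(** The weak tangent bound at the midpoint of [a] and [b], combined with strict convexity there,
    gives the strict bound at [b]. *)
Lemma cost_tangent_strict a b : A a -> A b -> b != a ->
  c a + \sum_(j < d) 'D_(delta_mx 0 j) c a * (b 0 j - a 0 j) < c b.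
Proof.
move=> Aa Ab ba.
have h0 : 0 < 2^-1 :> R by lra.
have h1 : 2^-1 < 1 :> R by lra.
have [_ [_ [_ [sc _]]]] := cok.
have := sc b a _ Ab Aa ba h0 h1.
have := cost_tangent a _ Aa (Aconv b a _ Ab Aa (ltW h0) (ltW h1)).
set S := \sum_(j < d) _; set S' := \sum_(j < d) _.
have -> : S = 2^-1 * S'.
  by rewrite /S /S' mulr_sumr; apply: eq_bigr => j _; rewrite !mxE; field.
by lra.
Qed.

(** Raising coordinate [j] alone may leave [A], so [a] is moved towards the projection of [b] on
    axis [j]. The moved point lies below a mixture of [a] and [b], hence in [A], and above
    [(1 - t) *: a]. Monotonicity and the tangent bound at [(1 - t) *: a] then leave exactly the term
    in coordinate [j]. *)
Lemma cost_gradient_ge0 a b j : A a -> A b -> 0 < b 0 j ->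
  0 <= 'D_(delta_mx 0 j) c a.
Proof.
move=> Aa Ab bj0.
have dca : differentiable c a by have [_ [_ [_ [_ [dc _]]]]] := cok; exact: dc.
pose v : 'rV[R]_d := b 0 j *: delta_mx 0 j - a.
have Dv : 'D_v c a = b 0 j * 'D_(delta_mx 0 j) c a
    - \sum_(k < d) 'D_(delta_mx 0 k) c a * a 0 k.
  rewrite derive_coord// -sumrN (bigD1 j)//= [in RHS](bigD1 j)//= addrA.
  congr (_ + _); first by rewrite !mxE !eqxx/=; ring.
  by apply: eq_bigr => k kj; rewrite !mxE (negbTE kj)/=; ring.
suff : - \sum_(k < d) 'D_(delta_mx 0 k) c a * a 0 k <= 'D_v c a.
  by rewrite Dv lerDr pmulr_rge0.
apply: derive_ge => // t t0 t1.
have A1 : A ((1 - t) *: a) by apply: downward_scale => //; lra.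
have A2 : A (t *: v + a).
  apply: (Adown (t *: b + (1 - t) *: a)); first by apply: Aconv => //; exact: ltW.
    move=> k; rewrite !mxE; have := Apos a Aa k; have := Apos b Ab j.
    by case: (k == j) => /=; nra.
  move=> k; rewrite !mxE; have := Apos b Ab k.
  by have [->|] := eqVneq k j => /=; nra.
have : c ((1 - t) *: a) <= c (t *: v + a).
  apply: cost_mono => // k; rewrite !mxE; have := Apos b Ab j.
  by case: (k == j) => /=; nra.
have := cost_tangent a _ Aa A1.
rewrite (eq_bigr (fun k => - t * ('D_(delta_mx 0 k) c a * a 0 k))); last first.
  by move=> k _; rewrite !mxE; ring.
rewrite -mulr_sumr; set S := \sum_(k < d) _; lra.
Qed.
End cost.

(** * The zero signal and uniquely optimal actions *)

Lemma conv_hull0 (R : realType) (d : nat) (X : set 'rV[R]_d) :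
  nonneg_orthant X -> conv_hull X 0 -> X 0.
Proof.
move=> Xpos [m [p [lam [Xp [lam0 [lam1 E]]]]]].
(* A point with positive weight must vanish, since no nonnegative coordinates can cancel. *)
have [i li] : exists i, 0 < lam i.
  apply: contrapT => /forallNP H; have := oner_neq0 R; rewrite -lam1 big1 ?eqxx//.
  by move=> i _; apply/eqP; rewrite eq_le lam0 andbT leNgt; exact/negP.
suff <- : p i = 0 by [].
apply/rowP => j; rewrite [RHS]mxE; apply/eqP; rewrite eq_le Xpos// andbT.
have : \sum_(i < m) lam i * p i 0 j = 0.
  have /(congr1 (fun x : 'rV_d => x 0 j)) := E; rewrite mxE summxE => E0.
  by rewrite [RHS]E0; apply: eq_bigr => k _; rewrite mxE.
rewrite (bigD1 i)//= => E0.
have : 0 <= \sum_(k < m | k != i) lam k * p k 0 j.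
  by apply: sumr_ge0 => k _; rewrite mulr_ge0// Xpos.
by nra.
Qed.

(** The set of best responses is the singleton of [a], so every tie-breaking rule returns [a]. *)
Lemma agent_action_unique (R : realType) (d n : nat) (A : set 'rV[R]_d)
    (c : 'rV[R]_d -> R) (tb : set 'rV[R]_d -> 'rV[R]_d)
    (w : 'I_n -> 'rV[R]_d -> R) (F : 'rV[R]_d -> probability (d.-tuple R) R)
    (U : 'rV[R]_d -> R) (a : 'rV[R]_d) :
  tie_rule A tb ->
  (forall b, A b -> expect (F b) (fun x => \sum_(i < n) w i x) = (U b)%:E) ->
  A a -> (forall b, A b -> b != a -> U b - c b < U a - c a) ->
  agent_action A c tb w F = a.
Proof.
move=> Htb UE Aa lt.
have BA : best_responses A c w F `<=` A by move=> x [].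
have Ba : best_responses A c w F a.
  split=> // b Ab; rewrite !UE// -!EFinB lee_fin.
  by have [->//|/(lt _ Ab)/ltW] := eqVneq b a.
have [] := Htb _ BA (ex_intro _ _ Ba).
rewrite -/(agent_action A c tb w F); set a' := agent_action _ _ _ _ _ => Aa' /(_ a Aa).
rewrite !UE// -!EFinB lee_fin leNgt => /negP nlt.
by apply/eqP; apply: contraT => /(lt _ Aa').
Qed.

(** * Optimal lottery *)

Lemma lottery_mixture2 (R : realType) (d : nat) (X : set 'rV[R]_d) (t : R)
    (a b : 'rV[R]_d) (mu nu : probability (d.-tuple R) R) :
  compact X -> 0 <= t -> t <= 1 -> lottery X a mu -> lottery X b nu ->
  exists2 rho, lottery X (t *: a + (1 - t) *: b) rho &
    forall f, contract_ok X f ->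
      mean rho f = t * mean mu f + (1 - t) * mean nu f.
Proof.
move=> cX t0 t1 la lb.
have sum2 (V : nmodType) (x y : V) :
    \sum_(i < 2) (if i == 0 :> nat then x else y) = x + y.
  by rewrite !big_ord_recl big_ord0 addr0.
have [||i|rho lot rhoE] := lottery_mixture X cX 2
    (fun i => if i == 0 :> nat then t else 1 - t)
    (fun i => if i == 0 :> nat then a else b)
    (fun i => if i == 0 :> nat then mu else nu).
- by move=> i; case: ifP => _ //; rewrite subr_ge0.
- by rewrite sum2 addrC subrK.
- by case: ifP.
exists rho => [|f okf].
  by move: lot; rewrite !big_ord_recl big_ord0 addr0.
by rewrite rhoE// !big_ord_recl big_ord0 addr0.
Qed.

Section optimum.
Context {R : realType} {d n : nat} (X A : set 'rV[R]_d) (c : 'rV[R]_d -> R).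
Hypotheses (cX : compact X) (Aconv : convex_set_rV A) (AX : A `<=` conv_hull X)
  (cok : cost_ok A c).

Lemma compatible_extension : exists2 F, compatible X A F &
  forall (a : 'rV[R]_d) (mu : probability (d.-tuple R) R), lottery X a mu ->
  compatible X A (fun b => if b == a then mu else F b).
Proof.
(* A dummy value for actions outside [A], where [compatible] asks nothing. *)
pose mu0 : probability (d.-tuple R) R := dirac ([tuple 0 | _ < d] : d.-tuple R).
have /choice[F HF] b : exists mu, A b -> lottery X b mu.
  have [/AX /(lottery_conv_hull X cX)[mu lot]|nAb] := pselect (A b).
    by exists mu.
  by exists mu0.
exists F => // a mu lot b Ab; case: eqVneq => [->//|_]; exact: HF.
Qed.

Variable w : 'I_n -> 'rV[R]_d -> R.
Hypotheses (wok : forall i, contract_ok X (w i))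
  (Hexists : forall F, compatible X A F -> best_responses A c w F !=set0).
Let W x := \sum_(i < n) w i x.

Let Wok : contract_ok X W. Proof. exact: contract_ok_sum. Qed.

(** Other lotteries at [a] itself are not compared with [mu]: once [F a] is set to [mu], the agent
    only weighs [a] against other actions. *)
Lemma optimal_lottery : exists a mu, [/\ A a, lottery X a mu &
  forall b nu, A b -> lottery X b nu -> b != a ->
    mean nu W - c b < mean mu W - c a].
Proof.
pose Q a s := exists2 mu, lottery X a mu & s = mean mu W - c a.
have [M WM] := Wok.1.
have A0 : A !=set0.
  by have [F /Hexists[a [Aa _]] _] := compatible_extension; exists a.
have Qex a : A a -> exists s, Q a s.
  by move=> /AX /(lottery_conv_hull X cX)[mu lot]; exists (mean mu W - c a), mu.
have QM a s : A a -> Q a s -> s <= M.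
  move=> Aa [mu [mu1 mua] ->].
  have : mean mu W <= mean mu (fun=> M).
    apply: (le_mean X cX) => //; first exact: contract_ok_cst.
    by move=> x /WM; rewrite ler_norml => /andP[].
  by rewrite (mean_cst X cX)//; have := cok.1 a Aa; lra.
have Qconc a b t : A a -> A b -> a != b -> 0 < t -> t < 1 ->
    exists2 g, 0 < g & forall r s, Q a r -> Q b s ->
      Q (t *: a + (1 - t) *: b) (t * r + (1 - t) * s + g).
  move=> Aa Ab ab t0 t1.
  (* Expected pay is linear under mixing of lotteries, so the gain is the convexity gap of [c] and
     is the same for all lotteries. *)
  exists (t * c a + (1 - t) * c b - c (t *: a + (1 - t) *: b)).
    by rewrite subr_gt0; have [_ [_ [_ [sc _]]]] := cok; exact: sc.
  move=> r s [mu lmu ->] [nu lnu ->].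
  have [rho lrho rhoE] := lottery_mixture2 _ _ X _ _ _ mu nu cX (ltW t0) (ltW t1) lmu lnu.
  by exists rho => //; rewrite rhoE//; ring.
have sel (f : 'rV[R]_d -> R) : (forall a, A a -> Q a (f a)) ->
    exists2 a, A a & forall b, A b -> f b <= f a.
  move=> fQ.
  pose mu0 : probability (d.-tuple R) R := dirac ([tuple 0 | _ < d] : d.-tuple R).
  have /choice[F HF] b : exists mu, A b -> lottery X b mu /\ f b = mean mu W - c b.
    have [/fQ[mu lot E]|nAb] := pselect (A b); first by exists mu.
    by exists mu0.
  have cF : compatible X A F by move=> b /HF[].
  have [a [Aa amax]] := Hexists F cF; exists a => // b Ab.
  have UE b' : A b' -> (expect (F b') W - (c b')%:E)%E = (f b')%:E.
    move=> Ab'; have [[l1 _] ->] := HF b' Ab'.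
    by rewrite (full_expect_mean X cX)// -EFinB.
  by have := amax b Ab; rewrite (UE b Ab) (UE a Aa) lee_fin.
have [a [s [Aa [mu lmu sE] max]]] :=
  strictly_concave_selection_max A Q M A0 Aconv Qex QM Qconc sel.
exists a, mu; split=> // b nu Ab lnu ba; rewrite -sE; apply: max ba => //.
by exists nu.
Qed.

End optimum.

(** * Affine contracts built from the optimal lottery *)

Theorem mainTheorem5 (R : realType) (d n : nat)
  (X A : set 'rV[R]_d) (c : 'rV[R]_d -> R)
  (u : 'I_n -> 'rV[R]_d -> R) (tb : set 'rV[R]_d -> 'rV[R]_d)
  (HX : compact X) (HXpos : nonneg_orthant X)
  (HA : compact A) (HApos : nonneg_orthant A) (HAconv : convex_set_rV A)
  (HAdown : downward_closed A) (HAX : A `<=` conv_hull X)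
  (Hc : cost_ok A c) (Htb : tie_rule A tb)
  (w : 'I_n -> 'rV[R]_d -> R)
  (Hw : forall i, contract_ok X (w i)) (HwLL : agg_LL X w)
  (Hexists : forall F, compatible X A F -> best_responses A c w F !=set0) :
  exists psi : 'I_n -> 'rV[R]_d -> R,
    (forall i, affine_contract (psi i)) /\ agg_LL X psi /\
    (forall i, (worst_payoff X A c tb u w i <= worst_payoff X A c tb u psi i)%E).
Proof.
pose W x := \sum_(i < n) w i x.
have Wok : contract_ok X W by exact: contract_ok_sum.
have [a [mu [Aa lmu amax]]] :=
  optimal_lottery X A c HX HAconv HAX Hc w Hw Hexists.
have [F0 _ F0ext] := compatible_extension X A HX HAX.
pose F b := if b == a then mu else F0 b.
have cF : compatible X A F by exact: F0ext.
have A00 : A 0.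
  rewrite -(scale0r a); exact: (downward_scale A HApos HAdown a 0 Aa).
have X0 : X 0 by apply: conv_hull0 => //; exact: HAX.
have [nu0 lnu0 nu0E] := lottery_dirac X HX 0 X0.
have dca : differentiable c a by have [_ [_ [_ [_ [dc _]]]]] := Hc; exact: dc.
pose g j : R := 'D_(delta_mx 0 j) c a.
pose ga : R := \sum_(j < d) g j * a 0 j.
have mW0 : 0 <= mean mu W.
  rewrite -(mean_cst X HX mu 0 lmu.1); apply: (le_mean X HX) => //.
  - exact: lmu.1.
  - exact: contract_ok_cst.
have ga_le : ga <= mean mu W.
  rewrite -lerN2.
  have <- : 'D_(- a) c a = - ga.
    by rewrite derive_coord// -sumrN; apply: eq_bigr => j _; rewrite !mxE mulrN.
  apply: derive_ge => // t t0 t1.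
  have -> : t *: - a + a = (1 - t) *: a + t *: 0.
    by rewrite scaler0 addr0 scalerBl scale1r scalerN addrC.
  have t0' : 0 <= 1 - t by lra.
  have t1' : 1 - t <= 1 by lra.
  have [rho lrho rhoE] :=
    lottery_mixture2 _ _ X _ _ _ mu nu0 HX t0' t1' lmu lnu0.
  rewrite subKr in lrho rhoE.
  (* If the shrunk action is still [a], then [amax] says nothing and [mW0] gives the bound. *)
  have [->|ne] := eqVneq ((1 - t) *: a + t *: 0) a; first by nra.
  have Am : A ((1 - t) *: a + t *: 0).
    by have := HAconv a 0 _ Aa A00 t0' t1'; rewrite subKr.
  have := amax _ rho Am lrho ne; rewrite rhoE// nu0E//.
  by have := HwLL 0 X0; rewrite -/(W 0); nra.
(* Signals in [X] may have positive coordinates that vanish on all of [A], where the sign of [g] is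
   not controlled; the positive part protects limited liability there. *)
pose b : 'rV[R]_d := \row_j Num.max (g j) 0.
have bA x : A x -> \sum_(j < d) b 0 j * x 0 j = \sum_(j < d) g j * x 0 j.
  move=> Ax; apply: eq_bigr => j _; rewrite mxE.
  have := HApos x Ax j; rewrite le_eqVlt => /predU1P[<-|xj]; first by rewrite !mulr0.
  by rewrite max_l// (cost_gradient_ge0 A c HApos HAconv HAdown Hc a x j).
pose e i := mean mu (w i).
(* The intercept makes [psi i a] equal to [e i], the expected payment of [w i] under [mu], while the
   slope [b] is shared equally. *)
pose psi0 i := e i - n%:R^-1 * ga.
pose psi (i : 'I_n) (x : 'rV[R]_d) : R := psi0 i + \sum_(j < d) (n%:R^-1 *: b) 0 j * x 0 j.
have psiE i x : psi i x = e i + n%:R^-1 * (\sum_(j < d) b 0 j * x 0 j - ga).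
  rewrite /psi /psi0 mulrBr -addrA; congr (_ + _); rewrite addrC.
  by congr (_ - _); rewrite mulr_sumr; apply: eq_bigr => j _; rewrite !mxE mulrA.
have sume : \sum_(i < n) e i = mean mu W.
  by rewrite -(mean_sum X HX)//; exact: lmu.1.
have psi_sum x : (0 < n)%N -> \sum_(i < n) psi i x =
    mean mu W + (\sum_(j < d) b 0 j * x 0 j - ga).
  move=> n0; under eq_bigr do rewrite psiE.
  rewrite big_split/= sume sumr_const card_ord -[X in _ + X = _]mulr_natl mulrA.
  by rewrite mulfV ?mul1r// pnatr_eq0 -lt0n.
have psiok i : contract_ok X (psi i) by exact: contract_ok_affine.
exists psi; split; first by move=> i; exists (psi0 i), (n%:R^-1 *: b).
split.
  (* The shares [1/n] add up to one only if there is a principal; otherwise the sum is empty. *)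
  move=> x Xx; have [n0|] := posnP n; last first.
    move=> n0; rewrite psi_sum//.
    have : 0 <= \sum_(j < d) b 0 j * x 0 j.
      apply: sumr_ge0 => j _; apply: mulr_ge0; last exact: HXpos.
      by rewrite mxE le_max lexx orbT.
    by lra.
  by apply: sumr_ge0 => -[i ilt]; exfalso; move: ilt; rewrite n0.
move=> i; have n0 : (0 < n)%N by apply: leq_ltn_trans (ltn_ord i).
have payoff_w : payoff A c tb u w F i = (u i a - e i)%:E.
  rewrite /payoff (agent_action_unique _ _ _ A c tb w F (fun b => mean (F b) W) a)//.
  - rewrite /F eqxx (full_expect_mean X HX)//; exact: lmu.1.
  - by move=> x Ax; rewrite (full_expect_mean X HX)//; have [] := cF x Ax.
  - move=> x Ax xa; rewrite {2}/F eqxx; apply: amax => //; exact: cF.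
(* The expectation of an affine contract depends on the mean alone, so the choice of [G] affects
   neither the agent's problem nor the payments. *)
have payoff_psi G : compatible X A G -> payoff A c tb u psi G i = (u i a - e i)%:E.
  move=> cG.
  rewrite /payoff (agent_action_unique _ _ _ A c tb psi G
    (fun x => \sum_(i < n) psi i x) a)//.
  - rewrite (full_expect_mean X HX)//; last by have [] := cG a Aa.
    rewrite (lottery_affine X HX a)//; last exact: cG.
    by rewrite -/(psi i a) psiE bA// -/ga subrr mulr0 addr0.
  - move=> x Ax; have lot := cG x Ax; have G1 := lot.1.
    rewrite (full_expect_mean X HX)//; last exact: contract_ok_sum.
    rewrite (mean_sum X HX)//; congr EFin; apply: eq_bigr => k _.
    exact: (lottery_affine X HX x).
  - move=> x Ax xa; rewrite !psi_sum// !bA//.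
    have := cost_tangent_strict A c HAconv Hc a x Aa Ax xa.
    rewrite (eq_bigr (fun j => g j * x 0 j - g j * a 0 j)); last first.
      by move=> j _; rewrite mulrBr.
    by rewrite sumrB -/ga; lra.
(* The single mapping [F] bounds the infimum for [w] from above, and the infimum for [psi] runs over
   a constant. *)
apply: (@le_trans _ _ (u i a - e i)%:E).
  by rewrite -payoff_w; apply: ereal_inf_lbound; exists F.
by apply: le_ereal_inf_tmp => _ [G cG <-]; rewrite payoff_psi.
Qed.
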